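(* Let $V$ be an $n$-dimensional vector space over a field of characteristic zero, let $A^{ab}$ and $B_{ab}$ be 2-forms, and let $P^a{}_b=A^{ac}B_{bc}$ and $T=P-\frac14[P]$. For even $k\geq 0$ define the $(1,1)$-tensors $$\mathrm{Idn}_k=\delta^{[a}_b A^{c_1c_2}\cdots A^{c_{k-1}c_k]}B_{c_1c_2}\cdots B_{c_{k-1}c_k},\qquad \mathrm{Id}_k=A^{a[c_1}A^{c_2c_3}\cdots A^{c_kc_{k+1}]}B_{bc_1}B_{c_2c_3}\cdots B_{c_kc_{k+1}}$$ (so $\mathrm{Id}_0=P$). Then for every even $k\geq2$: $$\mathrm{Idn}_k=-\frac{k}{k+1}\Bigl(\mathrm{Id}_{k-2}-\frac1k[\mathrm{Id}_{k-2}]\Bigr),\qquad \mathrm{Id}_k=-\frac{k}{k+1}P\Bigl(\mathrm{Id}_{k-2}-\frac1k[\mathrm{Id}_{k-2}]\Bigr),$$ and, if $n\neq4$, $$\mathrm{Id}_k=-\frac{k}{k+1}\Bigl(T\,\mathrm{Id}_{k-2}-\frac{1}{n-4}[T]\,\mathrm{Id}_{k-2}-\frac1k[\mathrm{Id}_{k-2}]\,T+\frac{1}{k(n-4)}[T][\mathrm{Id}_{k-2}]\Bigr).$$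
   Context: Square brackets around indices denote antisymmetrisation over the enclosed upper indices (here over $a,c_1,\dots,c_k$ in $\mathrm{Idn}_k$ and over $c_1,\dots,c_{k+1}$ in $\mathrm{Id}_k$). Index-free notation for $(1,1)$-tensors: products denote composition, $[X]=X^c{}_c$ is the trace, and scalar terms are multiplied by the identity $\delta^a_b$. No metric is assumed. *)

(* Defs.v *)
From HB Require Import structures.
From mathcomp Require Import all_boot all_order all_algebra all_fingroup.
Set Implicit Arguments. Unset Strict Implicit. Unset Printing Implicit Defensive.
Import GRing.Theory.
Local Open Scope ring_scope.

(* Tensors on V = F^n are represented by their component arrays in a basis:
   A^{ab} = A a b, B_{ab} = B a b, and a (1,1)-tensor X^a_b = X a b. *)
Section Tensors.
Variables (F : fieldType) (n : nat).

Definition alt (m : nat) (X : {ffun 'I_m -> 'I_n} -> F)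
    (c : {ffun 'I_m -> 'I_n}) : F :=
  (m`!%:R)^-1 * \sum_(s : 'S_m) (-1) ^+ odd_perm s * X [ffun i => c (s i)].

Definition pos1 (k : nat) (i : nat) : 'I_k.+1 := inord i.*2.+1.
Definition pos2 (k : nat) (i : nat) : 'I_k.+1 := inord i.*2.+2.

Definition pairprod (k : nat) (M : 'M[F]_n) (c : {ffun 'I_k.+1 -> 'I_n}) : F :=
  \prod_(i < k./2) M (c (pos1 k i)) (c (pos2 k i)).

Definition Pmx (A B : 'M[F]_n) : 'M[F]_n :=
  \matrix_(a, b) \sum_(c < n) A a c * B b c.

(* Idn_k = delta^{[a}_b A^{c1c2}...A^{c_{k-1}c_k]} B_{c1c2}...B_{c_{k-1}c_k};
   position 0 of the index tuple is a, positions 1..k are c_1..c_k *)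
Definition Idn (A B : 'M[F]_n) (k : nat) : 'M[F]_n :=
  \matrix_(a, b) \sum_(c : {ffun 'I_k.+1 -> 'I_n} | c ord0 == a)
     alt (fun d => (d ord0 == b)%:R * pairprod A d) c * pairprod B c.

(* Id_k = A^{a[c1} A^{c2c3}...A^{ck c_{k+1}]} B_{bc1} B_{c2c3}...B_{ck c_{k+1}};
   position j of the index tuple is c_{j+1} *)
Definition Id (A B : 'M[F]_n) (k : nat) : 'M[F]_n :=
  \matrix_(a, b) \sum_(c : {ffun 'I_k.+1 -> 'I_n})
     alt (fun d => A a (d ord0) * pairprod A d) c * (B b (c ord0) * pairprod B c).

End Tensors.

(* Main.v *)
Require Import Defs.
From HB Require Import structures.
From mathcomp Require Import all_boot all_order all_algebra all_fingroup ring.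
Import GRing.Theory.
Local Open Scope ring_scope.

(* Write Idn_k as a sum over permutations s of the k+1 index positions 0, 1, ..., k,
   position 0 carrying the free index a.  Each term is invariant under multiplying s
   on either side by a symmetry of the pairs (1,2), (3,4), ..., because A and B are
   antisymmetric.  The terms with s 0 = 0 therefore reduce to those that also fix 1,
   which give delta [Id_(k-2)]; the terms with s 0 <> 0 reduce to those that exchange
   0 and 1, which give - Id_(k-2).  This proves the first identity.  The second one
   follows from Id_k = A (Idn_k)^T B^T, since Id_(k-2) is self-adjoint for B by
   induction, and the third one is the second one with P expressed through T. *)

(** * Permutations fixing position 0, and index tuples split into head and tail *)

Section IndexTuples.

Lemma sum_perm_fix0 (R : nmodType) (m : nat) (f : 'S_m.+1 -> R) :
  \sum_(s : 'S_m.+1 | s ord0 == ord0) f s = \sum_(s : 'S_m) f (lift_perm ord0 ord0 s).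
Proof.
rewrite (reindex (lift_perm ord0 ord0)) /=.
  by apply: eq_bigl => s; rewrite lift_perm_id eqxx.
(* The inverse of [lift_perm ord0 ord0] restricts [s] to the nonzero positions. When [s] fixes
   [ord0], [unlift] succeeds and the default [k] never occurs. *)
pose ulsf (s : 'S_m.+1) (k : 'I_m) := odflt k (unlift ord0 (s (lift ord0 k))).
have ulsfK (s : 'S_m.+1) (k : 'I_m) : s ord0 = ord0 -> lift ord0 (ulsf s k) = s (lift ord0 k).
  move=> s0; rewrite /ulsf.
  have: ord0 != s (lift ord0 k) by rewrite -{1}s0 (can_eq (permK s)) neq_lift.
  by case/unlift_some=> j -> ->.
have ulsf_inj (s : 'S_m.+1) : s ord0 = ord0 -> injective (ulsf s).
  by move=> s0 i j /(congr1 (lift ord0)); rewrite !ulsfK // => /perm_inj/lift_inj.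
exists (fun s : 'S_m.+1 => if s ord0 =P ord0 is ReflectT e then perm (ulsf_inj s e) else 1%g).
  move=> s _; case: eqP => [e|]; last by rewrite lift_perm_id.
  by apply/permP=> i; rewrite permE; apply: (@lift_inj _ ord0); rewrite ulsfK // lift_perm_lift.
move=> s; rewrite inE => /eqP s0; case: eqP => // e; apply/permP=> i.
case: (unliftP ord0 i) => [j|] ->; last by rewrite lift_perm_id.
by rewrite lift_perm_lift permE ulsfK.
Qed.

Definition ffcons (T : Type) (m : nat) (x : T) (c : {ffun 'I_m -> T}) :
    {ffun 'I_m.+1 -> T} :=
  [ffun i => oapp c x (unlift ord0 i)].

Lemma ffcons0 (T : Type) (m : nat) (x : T) (c : {ffun 'I_m -> T}) :
  ffcons T m x c ord0 = x.
Proof. by rewrite ffunE unlift_none. Qed.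

Lemma ffcons_lift (T : Type) (m : nat) (x : T) (c : {ffun 'I_m -> T}) (i : 'I_m) :
  ffcons T m x c (lift ord0 i) = c i.
Proof. by rewrite ffunE liftK. Qed.

Lemma sum_ffcons (R : nmodType) (T : finType) (m : nat) (f : {ffun 'I_m.+1 -> T} -> R) :
  \sum_c f c = \sum_x \sum_c f (ffcons T m x c).
Proof.
rewrite pair_big /= (reindex (fun p : T * {ffun 'I_m -> T} => ffcons T m p.1 p.2)) //=.
exists (fun c : {ffun 'I_m.+1 -> T} => (c ord0, [ffun i => c (lift ord0 i)])).
  move=> [x c] _ /=; rewrite ffcons0; congr (_, _); apply/ffunP=> i.
  by rewrite ffunE ffcons_lift.
move=> c _ /=; apply/ffunP=> i; case: (unliftP ord0 i) => [j|] ->.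
  by rewrite ffcons_lift ffunE.
by rewrite ffcons0.
Qed.

Lemma perm_comp_ffunM (T : finType) (m : nat) (c : {ffun 'I_m -> T}) (s t : 'S_m) :
  [ffun i => c ((s * t)%g i)] = [ffun i => [ffun j => c (t j)] (s i)].
Proof. by apply/ffunP=> i; rewrite !ffunE permM. Qed.

End IndexTuples.

(** Serves to turn [n != 4] into invertibility of [n - 4] in the field. *)
Lemma natr_inj_pchar0 (R : idomainType) :
  [pchar R] =i pred0 -> injective (fun i : nat => i%:R : R).
Proof.
move/(pcharf0P R) => natr_eq0 i j.
wlog le_ij : i j / (i <= j)%N => [hwlog|] eq_ij.
  by case/orP: (leq_total i j) => le; [|symmetry]; apply: hwlog.
by apply/eqP; rewrite eqn_leq le_ij -subn_eq0 -natr_eq0 natrB // eq_ij subrr /=.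
Qed.

(** * Products over the pairs of positions, and their symmetries *)

Section PairProducts.
Variables (F : fieldType) (n : nat).
Implicit Types (M : 'M[F]_n) (a b : 'I_n).

(** For [i < k./2] one has 2i+2 <= k, so [inord] does not fall back on its default, here and in
    [pos2_val]. *)
Lemma pos1_val (k i : nat) : (i < k./2)%N -> pos1 k i = i.*2.+1 :> nat.
Proof.
move=> lt_i; rewrite /pos1 inordK // !ltnS -[leqRHS](odd_double_half k).
by apply: leq_trans (leq_addl _ _); rewrite ltn_double.
Qed.

Lemma pos2_val (k i : nat) : (i < k./2)%N -> pos2 k i = i.*2.+2 :> nat.
Proof.
move=> lt_i; rewrite /pos2 inordK // !ltnS -[leqRHS](odd_double_half k).
by apply: leq_trans (leq_addl _ _); rewrite -doubleS leq_double.
Qed.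

(** The old position 0 becomes position 2 and is paired with the new position 1, while the new
    position 0 lies in no pair. This is how the contractions of [Id] at [m] appear inside [Idn] at
    [m.+2]. *)
Lemma pairprod_ffcons2 (m : nat) M (x y : 'I_n) (c : {ffun 'I_m.+1 -> 'I_n}) :
  pairprod M (ffcons _ _ x (ffcons _ _ y c)) = M y (c ord0) * pairprod M c.
Proof.
have -> : forall c', pairprod (k := m.+2) M c' = \prod_(i < m./2.+1) M (c' (pos1 m.+2 i)) (c' (pos2 m.+2 i)) by [].
rewrite big_ord_recl.
have -> : pos1 m.+2 (ord0 : 'I_m./2.+1) = lift ord0 ord0 by apply: val_inj; rewrite /= pos1_val.
have -> : pos2 m.+2 (ord0 : 'I_m./2.+1) = lift ord0 (lift ord0 ord0).
  by apply: val_inj; rewrite /= pos2_val.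
rewrite !ffcons_lift ffcons0; congr (_ * _); apply: eq_bigr => i _.
have lt_i : (lift ord0 i < m.+2./2)%N by [].
have -> : pos1 m.+2 (lift ord0 i) = lift ord0 (lift ord0 (pos1 m i)).
  by apply: ord_inj; rewrite pos1_val // !lift0 pos1_val.
have -> : pos2 m.+2 (lift ord0 i) = lift ord0 (lift ord0 (pos2 m i)).
  by apply: ord_inj; rewrite pos2_val // !lift0 pos2_val.
by rewrite !ffcons_lift.
Qed.

(* The symmetries of the pair product of an antisymmetric form: every element
   of the hyperoctahedral group of the pairs (1,2), (3,4), ... is one. *)
Definition pair_sym (k : nat) (h : 'S_k.+1) : Prop :=
  h ord0 = ord0 /\
  forall M, M^T = - M -> forall c : {ffun 'I_k.+1 -> 'I_n},
    pairprod M [ffun i => c (h i)] = (-1) ^+ odd_perm h * pairprod M c.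

Lemma pair_symM (k : nat) (g h : 'S_k.+1) :
  pair_sym k g -> pair_sym k h -> pair_sym k (g * h)%g.
Proof.
move=> [g0 gM] [h0 hM]; split; first by rewrite permM g0 h0.
by move=> M antiM c; rewrite perm_comp_ffunM gM // hM // odd_permM signr_addb mulrA.
Qed.

Lemma pair_sym_flip (k : nat) (i : 'I_k./2) : pair_sym k (tperm (pos1 k i) (pos2 k i)).
Proof.
split; first by rewrite tpermD // -val_eqE /= ?pos1_val ?pos2_val.
move=> M antiM c; rewrite odd_tperm -val_eqE /= pos1_val // pos2_val //.
rewrite neq_ltn ltnSn /= expr1 mulN1r /pairprod (bigD1 i) //= [in RHS](bigD1 i) //= -mulNr.
rewrite !ffunE tpermL tpermR; congr (_ * _).
  by move/matrixP/(_ (c (pos1 k i)) (c (pos2 k i))): antiM; rewrite !mxE.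
apply: eq_bigr => j neq_ji; rewrite !ffunE !tpermD // -val_eqE /= ?pos1_val ?pos2_val //.
- by rewrite eqSS; apply/negP=> /eqP/(congr1 odd); rewrite /= !odd_double.
- by rewrite !eqSS (inj_eq double_inj) eq_sym.
- by rewrite eqSS (inj_eq double_inj) eq_sym.
- by rewrite eqSS; apply/negP=> /eqP/(congr1 odd); rewrite /= !odd_double.
Qed.

(** Exchanging two whole pairs only reorders the factors, and the two [tperm] have equal parity. *)
Lemma pair_sym_swap (k : nat) (i j : 'I_k./2) :
  pair_sym k (tperm (pos1 k i) (pos1 k j) * tperm (pos2 k i) (pos2 k j))%g.
Proof.
have neq12 (p q : 'I_k./2) : pos1 k p != pos2 k q.
  rewrite -val_eqE /= pos1_val // pos2_val // eqSS.
  by apply/negP=> /eqP/(congr1 odd); rewrite /= !odd_double.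
have neq21 (p q : 'I_k./2) : pos2 k p != pos1 k q by rewrite eq_sym.
have eq1 (p q : 'I_k./2) : (pos1 k p == pos1 k q) = (p == q).
  by rewrite -val_eqE /= !pos1_val // eqSS (inj_eq double_inj).
have eq2 (p q : 'I_k./2) : (pos2 k p == pos2 k q) = (p == q).
  by rewrite -val_eqE /= !pos2_val // !eqSS (inj_eq double_inj).
split; first by rewrite permM !tpermD // -val_eqE /= ?pos1_val ?pos2_val.
move=> M _ c; rewrite odd_permM !odd_tperm eq1 eq2 addbb expr0 mul1r /pairprod.
rewrite [RHS](reindex_inj (@perm_inj _ (tperm i j))); apply: eq_bigr => p _.
have t1 : tperm (pos1 k i) (pos1 k j) (pos1 k p) = pos1 k (tperm i j p).
  by case: (tpermP i j p) => [->|->|/eqP ni /eqP nj]; rewrite ?tpermL ?tpermR // tpermD // eq1 eq_sym.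
have t2 : tperm (pos2 k i) (pos2 k j) (pos2 k p) = pos2 k (tperm i j p).
  by case: (tpermP i j p) => [->|->|/eqP ni /eqP nj]; rewrite ?tpermL ?tpermR // tpermD // eq2 eq_sym.
by rewrite !ffunE !permM t1 [tperm _ _ (pos2 k p)]tpermD // t2 [tperm _ _ (pos1 _ _)]tpermD.
Qed.

(** Exchange the first pair with the pair of [q], then flip the latter if [q] is its second member.
    As [k] is even, every nonzero position lies in a pair. *)
Lemma pair_sym_trans (k : nat) (q : 'I_k.+3) :
  ~~ odd k -> q != ord0 -> exists2 h, pair_sym k.+2 h & h (lift ord0 ord0) = q.
Proof.
move=> even_k nz_q.
(* Pair i consists of positions 2i+1 and 2i+2, so [q] lies in pair (q-1)/2. *)
have lt_i : (q.-1./2 < k.+2./2)%N.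
  have := ltn_ord q; rewrite ltnS => le_q.
  have {le_q}: (q.-1 <= k.+1)%N by rewrite -ltnS prednK // lt0n.
  by move/half_leq; rewrite /= uphalf_half (negbTE even_k).
pose i : 'I_k.+2./2 := Ordinal lt_i.
have e0 : lift ord0 ord0 = pos1 k.+2 (ord0 : 'I_k./2.+1) by apply: val_inj; rewrite /= pos1_val.
have symh := pair_sym_swap k.+2 (ord0 : 'I_k./2.+1) i.
set h := (_ * _)%g in symh.
have h1 : h (lift ord0 ord0) = pos1 k.+2 i.
  rewrite e0 permM tpermL tpermD //;
  by rewrite -val_eqE /= pos2_val // pos1_val // eqSS; apply/negP=> /eqP/(congr1 odd); rewrite /= !odd_double.
have q_gt0 : (0 < q)%N by rewrite lt0n.
have := odd_double_half q.-1; case: (odd _) => /= def_q.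
  exists (h * tperm (pos1 k.+2 i) (pos2 k.+2 i))%g.
    by apply: pair_symM => //; apply: pair_sym_flip.
  by rewrite permM h1 tpermL; apply: val_inj; rewrite /= pos2_val //= -(prednK q_gt0) -{2}def_q.
exists h => //; rewrite h1; apply: val_inj; rewrite /= pos1_val //= -[RHS](prednK q_gt0).
by rewrite -[in RHS]def_q.
Qed.

End PairProducts.

(** * Expansion of [Idn] and [Id] over permutations *)

Section IdnAntisymmetrizer.
Variables (F : fieldType) (n : nat) (A B : 'M[F]_n).

(** Both index conditions are 0-1 factors, so that the sum runs over all tuples and can be reindexed
    by a permutation of the positions. The factor 1/(k+1)! is left out. *)
Definition Idn_term (k : nat) (a b : 'I_n) (s : 'S_k.+1) : F :=
  (-1) ^+ odd_perm s * \sum_(c : {ffun 'I_k.+1 -> 'I_n})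
    (c (s ord0) == b)%:R * (c ord0 == a)%:R *
    (pairprod A [ffun i => c (s i)] * pairprod B c).

Definition Id_term (k : nat) (a b : 'I_n) (s : 'S_k.+1) : F :=
  (-1) ^+ odd_perm s * \sum_(c : {ffun 'I_k.+1 -> 'I_n})
    (A a (c (s ord0)) * pairprod A [ffun i => c (s i)]) * (B b (c ord0) * pairprod B c).

Lemma Idn_sum (k : nat) (a b : 'I_n) :
  Idn A B k a b = (k.+1`!%:R)^-1 * \sum_s Idn_term k a b s.
Proof.
rewrite mxE big_mkcond /= mulr_sumr.
under [RHS]eq_bigr => s _ do rewrite /Idn_term !mulr_sumr.
rewrite exchange_big /=; apply: eq_bigr => c _; rewrite /alt.
rewrite -mulr_sumr.
case: eqP => _; last by rewrite big1 ?mulr0 // => s _; rewrite !(mulr0, mul0r).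
rewrite -[LHS]mulrA; congr (_ * _); rewrite mulr_suml; apply: eq_bigr => s _.
by rewrite ffunE mulr1 !mulrA.
Qed.

Lemma Id_sum (k : nat) (a b : 'I_n) :
  Id A B k a b = (k.+1`!%:R)^-1 * \sum_s Id_term k a b s.
Proof.
rewrite mxE mulr_sumr.
under [RHS]eq_bigr => s _ do rewrite /Id_term !mulr_sumr.
rewrite exchange_big /=; apply: eq_bigr => c _; rewrite /alt.
rewrite -mulr_sumr -[LHS]mulrA; congr (_ * _); rewrite mulr_suml; apply: eq_bigr => s _.
by rewrite ffunE !mulrA.
Qed.

Lemma sum_delta2 (G : 'I_n -> F) (a b : 'I_n) :
  \sum_x (x == b)%:R * (x == a)%:R * G x = (a == b)%:R * G a.
Proof.
rewrite (bigD1 a) //= eqxx mulr1 big1 ?addr0 // => x /negbTE ->.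
by rewrite mulr0 mul0r.
Qed.

Lemma ffcons_lift_perm (m : nat) (x : 'I_n) (c : {ffun 'I_m -> 'I_n}) (s : 'S_m) :
  [ffun i => ffcons _ _ x c (lift_perm ord0 ord0 s i)] = ffcons _ _ x [ffun i => c (s i)].
Proof.
apply/ffunP=> i; rewrite ffunE; case: (unliftP ord0 i) => [j|] ->.
  by rewrite lift_perm_lift !ffcons_lift ffunE.
by rewrite lift_perm_id !ffcons0.
Qed.

Lemma ffcons_tperm (m : nat) (x y : 'I_n) (c : {ffun 'I_m -> 'I_n}) :
  [ffun i => ffcons _ _ x (ffcons _ _ y c) (tperm ord0 (lift ord0 ord0) i)]
  = ffcons _ _ y (ffcons _ _ x c).
Proof.
apply/ffunP=> i; rewrite ffunE; case: (unliftP ord0 i) => [j|] ->; last first.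
  by rewrite tpermL !ffcons_lift !ffcons0.
case: (unliftP ord0 j) => [l|] ->.
  by rewrite tpermD // !ffcons_lift.
by rewrite tpermR !ffcons_lift !ffcons0.
Qed.

(** The delta compares position 0 with itself. Position 1, with value [y], starts the first pair of
    both [A] and [B], and summing over [y] gives a trace. *)
Lemma Idn_term_fix01 (m : nat) (a b : 'I_n) (s : 'S_m.+1) :
  Idn_term m.+2 a b (lift_perm ord0 ord0 (lift_perm ord0 ord0 s))
  = (a == b)%:R * \sum_y Id_term m y y s.
Proof.
rewrite /Idn_term !odd_lift_perm /= -mulr_sumr [RHS]mulrCA; congr (_ * _).
rewrite sum_ffcons lift_perm_id.
under eq_bigr => x _.
  under eq_bigr => c _ do rewrite ffcons0.
  rewrite -mulr_sumr; over.
rewrite sum_delta2; congr (_ * _); rewrite sum_ffcons; apply: eq_bigr => y _.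
by apply: eq_bigr => c _; rewrite !ffcons_lift_perm !pairprod_ffcons2 ffunE.
Qed.

(** Position 0 has value [a] and the delta forces the value [b] at position 1. After the exchange
    the first pair of [A] starts with [a] and that of [B] with [b]; the sign is that of the
    transposition. *)
Lemma Idn_term_swap01 (m : nat) (a b : 'I_n) (s : 'S_m.+1) :
  Idn_term m.+2 a b (tperm ord0 (lift ord0 ord0) * lift_perm ord0 ord0 (lift_perm ord0 ord0 s))
  = - Id_term m a b s.
Proof.
rewrite /Idn_term odd_permM !odd_lift_perm odd_tperm neq_lift /= signrN mulNr; congr (- (_ * _)).
rewrite sum_ffcons (bigD1 a) //= [X in _ + X]big1 ?addr0; last first.
  by move=> x /negbTE nxa; rewrite big1 // => c _; rewrite ffcons0 nxa mulr0 mul0r.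
rewrite sum_ffcons (bigD1 b) //= [X in _ + X]big1 ?addr0; last first.
  move=> x /negbTE nxb; rewrite big1 // => c _.
  by rewrite permM tpermL lift_perm_lift lift_perm_id ffcons_lift ffcons0 nxb !mul0r.
apply: eq_bigr => c _.
rewrite permM tpermL lift_perm_lift lift_perm_id ffcons_lift !ffcons0 !eqxx !mul1r.
by rewrite perm_comp_ffunM !ffcons_lift_perm ffcons_tperm !pairprod_ffcons2 ffunE.
Qed.

Hypotheses (hA : A^T = - A) (hB : B^T = - B).

(** Here [h] permutes the tuple read by [A], and the resulting sign cancels that of [h] in
    [odd_perm (h * s)]. *)
Lemma Idn_term_symMl (k : nat) (a b : 'I_n) (h s : 'S_k.+1) :
  pair_sym F n k h -> Idn_term k a b (h * s) = Idn_term k a b s.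
Proof.
move=> [h0 hM]; rewrite /Idn_term !mulr_sumr; apply: eq_bigr => c _.
rewrite perm_comp_ffunM permM h0.
rewrite hM // odd_permM signr_addb -[RHS](signrMK (odd_perm h)) -!mulrA; congr (_ * _).
rewrite [RHS]mulrCA; congr (_ * _).
by rewrite [RHS]mulrCA; congr (_ * _); rewrite [RHS]mulrCA.
Qed.

(** Reindexing the tuples by [h] makes the compensating sign come from the product of [B]. *)
Lemma Idn_term_symMr (k : nat) (a b : 'I_n) (h s : 'S_k.+1) :
  pair_sym F n k h -> Idn_term k a b (s * h) = Idn_term k a b s.
Proof.
move=> [h0 hM]; rewrite /Idn_term.
pose act (c : {ffun 'I_k.+1 -> 'I_n}) := [ffun i => c (h i)].
have act_bij : {on [pred c | true], bijective act}.
  exists (fun c => [ffun i => c ((h^-1)%g i)]) => c _; apply/ffunP=> i; rewrite !ffunE.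
    by rewrite permKV.
  by rewrite permK.
rewrite [in RHS](reindex act) //= !mulr_sumr; apply: eq_bigr => c _.
rewrite perm_comp_ffunM [act c (s ord0)]ffunE [act c ord0]ffunE permM h0 hM //.
rewrite odd_permM signr_addb -!mulrA; congr (_ * _).
rewrite mulrCA; congr (_ * _).
by rewrite mulrCA; congr (_ * _); rewrite mulrCA.
Qed.

End IdnAntisymmetrizer.

(** * Sums over permutations of functions invariant under the pair symmetries *)

Section SymmetricSums.
Variables (F : fieldType) (n m : nat) (f : 'S_m.+3 -> F).
Hypothesis even_m : ~~ odd m.
Hypothesis fMl : forall h s, pair_sym F n m.+2 h -> f (h * s) = f s.
Hypothesis fMr : forall h s, pair_sym F n m.+2 h -> f (s * h) = f s.

Let i1 : 'I_m.+3 := lift ord0 ord0.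

(** Classify [s] by the position q that it sends to [y]: it is nonzero because [x != y], which
    leaves m+2 classes. Left multiplication by a pair symmetry matches each class with that of
    position 1. *)
Lemma sum_perm_at0 (x y : 'I_m.+3) : x != y ->
  \sum_(s : 'S_m.+3 | s ord0 == x) f s
  = (\sum_(s : 'S_m.+3 | (s ord0 == x) && (s i1 == y)) f s) *+ m.+2.
Proof.
move=> neq_xy.
rewrite (partition_big (fun s : 'S_m.+3 => (s^-1)%g y) (predC1 ord0)) /=; last first.
  move=> s /eqP sx; apply/negP=> /eqP sy; case/negP: neq_xy.
  by rewrite -sx -sy permKV.
have card_neq0 : m.+2 = #|predC1 (ord0 : 'I_m.+3)| by rewrite cardC1 card_ord.
rewrite [X in _ *+ X]card_neq0 -sumr_const.
apply: eq_bigr => q nz_q; have [h symh hq] := pair_sym_trans F n m q even_m nz_q.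
rewrite (reindex_inj (mulgI h^-1)%g) /=; apply: eq_big => s; last first.
  by move=> _; rewrite -(fMl h) // mulKVg.
have hV0 : (h^-1)%g ord0 = ord0 by apply: (@perm_inj _ h); rewrite permKV (proj1 symh).
rewrite permM hV0; congr (_ && _).
by rewrite (canF_eq (permKV _)) permM -hq permK eq_sym.
Qed.

(** Here the classes are the values of [s] at 0, and right multiplication moves these values. *)
Lemma sum_perm_not0 :
  \sum_(s : 'S_m.+3 | s ord0 != ord0) f s
  = (\sum_(s : 'S_m.+3 | s ord0 == i1) f s) *+ m.+2.
Proof.
rewrite (partition_big (fun s : 'S_m.+3 => s ord0) (predC1 ord0)) //=.
have card_neq0 : m.+2 = #|predC1 (ord0 : 'I_m.+3)| by rewrite cardC1 card_ord.
rewrite [X in _ *+ X]card_neq0 -sumr_const.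
apply: eq_bigr => q nz_q; have [h symh hq] := pair_sym_trans F n m q even_m nz_q.
rewrite (reindex_inj (mulIg h)) /=; apply: eq_big => s; last by rewrite fMr.
rewrite permM andb_idl; last by move/eqP->.
by rewrite -hq (inj_eq perm_inj).
Qed.

Lemma sum_perm_fix01 (g : 'S_m.+3 -> F) :
  \sum_(s : 'S_m.+3 | (s ord0 == ord0) && (s i1 == i1)) g s
  = \sum_(s : 'S_m.+1) g (lift_perm ord0 ord0 (lift_perm ord0 ord0 s)).
Proof.
rewrite big_mkcondr sum_perm_fix0 -big_mkcond /=.
rewrite -(sum_perm_fix0 _ _ (fun s : 'S_m.+2 => g (lift_perm ord0 ord0 s))).
by apply: eq_bigl => s; rewrite lift_perm_lift (inj_eq lift_inj).
Qed.

(** The multiplicities agree with (m+3)! = ((m+2) + (m+2)^2) (m+1)!. *)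
Lemma sum_perm_pair_sym :
  \sum_s f s =
    (\sum_(s : 'S_m.+1) f (lift_perm ord0 ord0 (lift_perm ord0 ord0 s))) *+ m.+2
  + (\sum_(s : 'S_m.+1) f (tperm ord0 i1 * lift_perm ord0 ord0 (lift_perm ord0 ord0 s)))
      *+ m.+2 *+ m.+2.
Proof.
rewrite (bigID (fun s : 'S_m.+3 => s ord0 == ord0)) /= (sum_perm_at0 ord0 i1) //.
rewrite sum_perm_not0 (sum_perm_at0 i1 ord0) // -!sum_perm_fix01.
rewrite -(sum_perm_fix01 (fun s => f (tperm ord0 i1 * s)%g)).
congr (_ + _ *+ _ *+ _); rewrite (reindex_inj (mulgI (tperm ord0 i1))) /=.
by apply: eq_bigl => s; rewrite !permM tpermL tpermR andbC.
Qed.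

End SymmetricSums.

(** * The recursions for [Idn] and [Id] *)

Section Recursion.
Variables (F : fieldType) (n : nat) (A B : 'M[F]_n).
Hypothesis charF0 : [pchar F] =i pred0.
Hypotheses (hA : A^T = - A) (hB : B^T = - B).

(** The trace term has multiplicity m+2 and the term - Id has (m+2)^2, each with a factor (m+1)!.
    Dividing by (m+3)! leaves (delta [Id] - (m+2) Id)/(m+3). *)
Lemma Idn_rec (m : nat) : ~~ odd m ->
  Idn A B m.+2 = - (m.+2%:R / m.+3%:R) *: (Id A B m - (m.+2%:R^-1 * \tr (Id A B m))%:M).
Proof.
move=> even_m; have natr_eq0 := (pcharf0P F).1 charF0.
apply/matrixP=> a b; rewrite Idn_sum.
rewrite (sum_perm_pair_sym F n m) // => [|h s symh|h s symh]; first last.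
- exact: Idn_term_symMr.
- exact: Idn_term_symMl.
under eq_bigr => s _ do rewrite Idn_term_fix01.
under [X in _ + X *+ _ *+ _]eq_bigr => s _ do rewrite Idn_term_swap01.
rewrite -mulr_sumr exchange_big sumrN /=.
have fact_neq0 : m.+1`!%:R != 0 :> F by rewrite natr_eq0 -lt0n fact_gt0.
have IdE x y : \sum_s Id_term F n A B m x y s = m.+1`!%:R * Id A B m x y.
  by rewrite Id_sum mulrA divff ?mul1r.
under eq_bigr => y _ do rewrite IdE.
rewrite IdE -mulr_sumr -/(\tr (Id A B m)) {IdE}.
move: (Id A B m) => I; rewrite !mxE (factS m.+2) (factS m.+1).
move: (m.+1`!) fact_neq0 => N1 N1_neq0; rewrite !natrM.
have mulrN2 (x : F) : x *+ m.+2 = x * m.+2%:R by rewrite mulr_natr.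
have : m.+2%:R != 0 :> F by rewrite natr_eq0.
have : m.+3%:R != 0 :> F by rewrite natr_eq0.
move: (m.+3%:R : F) (m.+2%:R : F) mulrN2 => N3 N2 mulrN2 N3_neq0 N2_neq0.
rewrite !mulrN2; case: (a == b); rewrite ?mulr1n ?mulr0n; field;
  by rewrite N3_neq0 N2_neq0 N1_neq0.
Qed.

(** Expanding [v] in deltas, with [v] a row of [A], exhibits [Id] as a contraction of [Idn]. *)
Lemma alt_delta (k : nat) (v : 'I_n -> F) (X : {ffun 'I_k.+1 -> 'I_n} -> F)
    (c : {ffun 'I_k.+1 -> 'I_n}) :
  alt (fun d => v (d ord0) * X d) c
  = \sum_x v x * alt (fun d => (d ord0 == x)%:R * X d) c.
Proof.
rewrite /alt; under [RHS]eq_bigr => x _ do rewrite mulrCA mulr_sumr.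
rewrite -mulr_sumr exchange_big /=; congr (_ * _); apply: eq_bigr => s _.
set d := [ffun _ => _]; rewrite (bigD1 (d ord0)) //= big1 ?addr0 => [|x /negbTE neq_x].
  by rewrite eqxx mul1r mulrCA.
by rewrite eq_sym neq_x mul0r !mulr0.
Qed.

(** The upper index of [Idn] is contracted with [B] and the lower one with [A], hence the
    transpose. *)
Lemma Id_Idn (k : nat) : Id A B k = A *m (Idn A B k)^T *m B^T.
Proof.
apply/matrixP=> a b; rewrite !mxE.
rewrite (partition_big (fun c : {ffun 'I_k.+1 -> 'I_n} => c ord0) predT) //=.
apply: eq_bigr => y _; rewrite !mxE mulr_suml.
under [RHS]eq_bigr => x _ do rewrite !mxE mulr_sumr mulr_suml.
rewrite exchange_big /=; apply: eq_bigr => c /eqP c0.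
rewrite c0 alt_delta mulr_suml; apply: eq_bigr => x _.
by rewrite [B b y * _]mulrC !mulrA.
Qed.

Lemma Pmx_mul : Pmx A B = A *m B^T.
Proof. by apply/matrixP=> a b; rewrite !mxE; apply: eq_bigr => c _; rewrite mxE. Qed.

Lemma Idn0 : Idn A B 0 = 1%:M.
Proof.
apply/matrixP=> a b; rewrite Idn_sum (factS 0) fact0 muln1 invr1 mul1r.
rewrite (bigD1 (1%g : 'S_1)) //= [X in _ + X]big1 ?addr0; last first.
  by move=> s /eqP[]; apply/permP=> i; rewrite !ord1.
rewrite /Idn_term odd_perm1 mul1r perm1 sum_ffcons.
under eq_bigr => x _.
  under eq_bigr => c _ do rewrite ffcons0 /pairprod !big_ord0.
  rewrite -mulr_sumr; over.
by rewrite sum_delta2 sumr_const card_ffun !card_ord expn0 !mulr1 !mxE.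
Qed.

Lemma Id0 : Id A B 0 = Pmx A B.
Proof. by rewrite Id_Idn Idn0 trmx1 mulmx1 Pmx_mul. Qed.

(** Self-adjointness of [X] for [B] carries [B^T] across the transpose, which leaves A B^T = P in
    front. *)
Lemma Id_step (t : F) (X : 'M[F]_n) :
  B^T *m X = X^T *m B^T -> A *m (X - t%:M)^T *m B^T = Pmx A B *m (X - t%:M).
Proof.
move=> BX; rewrite linearB /= tr_scalar_mx Pmx_mul -!mulmxA; congr (_ *m _).
by rewrite mulmxBl mulmxBr BX scalar_mxC.
Qed.

(* Both hold because Id_m is a polynomial in P. *)
Lemma Id_adjoint (m : nat) : ~~ odd m ->
  B^T *m Id A B m = (Id A B m)^T *m B^T /\ Pmx A B *m Id A B m = Id A B m *m Pmx A B.
Proof.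
have BP : B^T *m Pmx A B = (Pmx A B)^T *m B^T.
  by rewrite Pmx_mul trmx_mul trmxK hA hB !(mulmxN, mulNmx) mulmxA.
rewrite -[m]odd_double_half; case: (odd m) => //; first by rewrite /= odd_double.
rewrite add0n => _; elim: m./2 => [|i [IHB IHP]]; first by rewrite Id0.
rewrite doubleS Id_Idn Idn_rec ?odd_double // linearZ /= -scalemxAr -scalemxAl Id_step //.
move: (Id A B i.*2) (_^-1 * _) (- _) IHB IHP => X t c BX PX.
have BXt : B^T *m (X - t%:M) = (X - t%:M)^T *m B^T.
  by rewrite [(X - _)^T]linearB /= tr_scalar_mx mulmxBl mulmxBr BX scalar_mxC.
have PXt : Pmx A B *m (X - t%:M) = (X - t%:M) *m Pmx A B.
  by rewrite mulmxBl mulmxBr PX scalar_mxC.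
split; last by rewrite -scalemxAr -scalemxAl -mulmxA -PXt.
rewrite -scalemxAr [(c *: _)^T]linearZ /= -scalemxAl; congr (_ *: _).
(* With Y = X - t: B^T P Y = B^T Y P = Y^T B^T P = Y^T P^T B^T. The first equality is why the
   induction also carries commutation with P. *)
by rewrite {1}PXt mulmxA BXt trmx_mul -!mulmxA BP.
Qed.

Lemma Id_rec (m : nat) : ~~ odd m ->
  Id A B m.+2 = - (m.+2%:R / m.+3%:R) *:
    (Pmx A B *m (Id A B m - (m.+2%:R^-1 * \tr (Id A B m))%:M)).
Proof.
move=> even_m; have [BX _] := Id_adjoint m even_m.
by rewrite Id_Idn Idn_rec // linearZ /= -scalemxAr -scalemxAl Id_step.
Qed.

End Recursion.

Theorem theorem9 (F : fieldType) (n : nat) (charF0 : [pchar F] =i pred0)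
  (A B : 'M[F]_n) (hA : A^T = - A) (hB : B^T = - B)
  (k : nat) (hk_even : ~~ odd k) (hk2 : (2 <= k)%N) :
  let P := Pmx A B in
  let T := P - (4%:R^-1 * \tr P)%:M in
  let I := Id A B (k - 2) in
  let c := - (k%:R / k.+1%:R) in
  [/\ Idn A B k = c *: (I - (k%:R^-1 * \tr I)%:M),
      Id A B k = c *: (P *m (I - (k%:R^-1 * \tr I)%:M))
    & n != 4%N ->
      Id A B k = c *: (T *m I - ((n%:R - 4%:R)^-1 * \tr T) *: I
                        - (k%:R^-1 * \tr I) *: T
                        + ((k%:R * (n%:R - 4%:R))^-1 * \tr T * \tr I)%:M)].
Proof.
case: k hk_even hk2 => [|[|m]] //= even_m _; rewrite !subSS subn0.
rewrite negbK in even_m.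
split=> [||n_neq4]; [exact: Idn_rec | exact: Id_rec |].
rewrite Id_rec //; congr (_ *: _).
have natr_eq0 := (pcharf0P F).1 charF0.
have N_neq0 : m.+2%:R != 0 :> F by rewrite natr_eq0.
have four_neq0 : 4%:R != 0 :> F by rewrite natr_eq0.
have n4_neq0 : n%:R - 4%:R != 0 :> F.
  by rewrite subr_eq0; apply: contra n_neq4 => /eqP /(natr_inj_pchar0 F charF0) ->.
move: (Id A B m) (Pmx A B) (m.+2%:R : F) N_neq0 => X P N N_neq0.
(* The identity has trace n, so [T] = [P] - n[P]/4; the factor n - 4 then cancels in both
   coefficients that contain [T]. *)
have trT : \tr (P - (4%:R^-1 * \tr P)%:M) = - (4%:R^-1 * \tr P) * (n%:R - 4%:R).
  by rewrite linearB /= mxtrace_scalar -mulr_natr; field.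
have -> : (n%:R - 4%:R)^-1 * \tr (P - (4%:R^-1 * \tr P)%:M) = - (4%:R^-1 * \tr P).
  by rewrite trT mulrC mulfK.
have -> : (N * (n%:R - 4%:R))^-1 * \tr (P - (4%:R^-1 * \tr P)%:M) * \tr X
          = - (4%:R^-1 * \tr P) * (N^-1 * \tr X).
  by rewrite trT; field; rewrite n4_neq0 N_neq0 four_neq0.
move: (4%:R^-1 * \tr P) (N^-1 * \tr X) => p t.
(* The right-hand side now reads (P - p)X + pX - t(P - p) - pt, which is PX - tP. *)
rewrite mulmxBr mulmxBl mul_mx_scalar mul_scalar_mx scaleNr opprK subrK.
rewrite scalerBr scale_scalar_mx mulNr [p * t]mulrC rmorphN /=.
by rewrite opprB addrA addrAC addrK.
Qed.
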